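(* Let $\mathbb{Y}$ be a subspace of the real space $\ell_1^n$ and let $\mathcal{A} = \{\widetilde{a}_1, \widetilde{a}_2, \ldots, \widetilde{a}_m\}$ be a basis of $\mathbb{Y}$, where $1 < m < n$ and $\widetilde{a}_k = (a_1^k, a_2^k, \ldots, a_n^k)$ for each $1 \le k \le m$. Then: (i) If $\mathcal{Z}_{\mathcal{A}} \ne \emptyset$, then $\mathbb{Y}$ is not an anti-coproximinal subspace of $\ell_1^n$. (ii) If $\mathcal{Z}_{\mathcal{A}} = \emptyset$, then $\mathbb{Y}$ is an anti-coproximinal subspace of $\ell_1^n$ if and only if $\dim(\operatorname{span} \mathcal{N}) = n$, where $\mathcal{N} \subset \ell_\infty^n$ is the minimal norming set of $\mathbb{Y}$.
   Context: The zero set of $\mathcal{A}$ is $\mathcal{Z}_{\mathcal{A}} = \{i \in \{1,\ldots,n\} : (a_i^1, a_i^2, \ldots, a_i^m) = (0, \ldots, 0)\}$. Let $\psi : \ell_1^n \to (\ell_\infty^n)^*$ be the canonical isometric isomorphism, $\psi(b)(x) = \sum_{i=1}^n b_i x_i$. For $g \in (\ell_\infty^n)^*$, $M_g = \{x \in S_{\ell_\infty^n} : |g(x)| = \|g\|\}$ is its norm attainment set, and $Ext(B_{\ell_\infty^n}) = \{-1,1\}^n$ is the set of extreme points of the unit ball. A set $S$ is symmetric if $x \in S$ implies $-x \in S$. A symmetric set $\mathcal{N} \subset \ell_\infty^n$ is a norming set of $\mathbb{Y}$ if $(M_g \cap Ext(B_{\ell_\infty^n})) \cap \mathcal{N} \ne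 \emptyset$ for each $g \in \psi(\mathbb{Y})$. A norming set $\mathcal{N}$ is a minimal norming set if for every norming set $\mathcal{M}$ of $\mathbb{Y}$, $\mathcal{M} \subset \mathcal{N}$ implies $\mathcal{M} = \mathcal{N}$. It is known that the minimal norming set of $\mathbb{Y}$ is unique when $\mathcal{Z}_{\mathcal{A}} = \emptyset$. An element $y_0 \in \mathbb{Y}$ is a best coapproximation to $x \in \ell_1^n$ out of $\mathbb{Y}$ if $\|y_0 - y\| \le \|x - y\|$ for all $y \in \mathbb{Y}$. $\mathbb{Y}$ is anti-coproximinal in $\ell_1^n$ if for every $x \in \ell_1^n \setminus \mathbb{Y}$ there does not exist any best coapproximation to $x$ out of $\mathbb{Y}$. *)

(* Defs.v *)
From HB Require Import structures.
From mathcomp Require Import all_boot all_order all_algebra.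
From mathcomp Require Import all_classical all_reals all_analysis.
From mathcomp Require Import lra.

Set Implicit Arguments.
Unset Strict Implicit.
Unset Printing Implicit Defensive.

Import Order.TTheory GRing.Theory Num.Theory.
Import numFieldNormedType.Exports.

Local Open Scope classical_set_scope.
Local Open Scope ring_scope.

(* Both $\ell_1^n$ and $\ell_\infty^n$ have carrier ['rV[R]_n].  The norm       *)
(* [`|x|] that MathComp-Analysis puts on ['rV[R]_n] is the maximum norm, so it *)
(* is the norm of $\ell_\infty^n$; the norm of $\ell_1^n$ is [l1norm].         *)

Definition l1norm (R : realType) (n : nat) (x : 'rV[R]_n) : R :=
  \sum_(i < n) `|x ord0 i|.

Section Approximation.
Variables (R : realType) (n : nat).
Implicit Types (Y : {vspace 'rV[R]_n}) (x y : 'rV[R]_n).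

Definition best_coapproximation Y x y0 : Prop :=
  y0 \in Y /\ forall y, y \in Y -> l1norm (y0 - y) <= l1norm (x - y).

Definition anti_coproximinal Y : Prop :=
  forall x, x \notin Y -> ~ exists y0, best_coapproximation Y x y0.

Definition zero_set (m : nat) (A : m.-tuple 'rV[R]_n) : set 'I_n :=
  [set i | forall k : 'I_m, tnth A k ord0 i = 0].

End Approximation.

(* The dual of $\ell_\infty^n$ is represented by [{scalar 'rV[R]_n}], the type *)
(* of all linear forms: in finite dimension each of them is continuous.        *)
Section Duality.
Variables (R : realType) (n : nat).
Implicit Types (b x : 'rV[R]_n) (g : {scalar 'rV[R]_n}).

Definition pairing b x : R := \sum_(i < n) b ord0 i * x ord0 i.

Lemma pairing_is_linear b : scalar (pairing b).
Proof.
move=> a x y; rewrite /pairing mulr_sumr -big_split /=.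
by apply: eq_bigr => i _; rewrite !mxE mulrDr mulrCA.
Qed.

HB.instance Definition _ b :=
  GRing.isLinear.Build R 'rV[R]_n R *%R (pairing b) (pairing_is_linear b).

Definition psi b : {scalar 'rV[R]_n} := pairing b.

Definition linf_ball : set 'rV[R]_n := [set x | `|x| <= 1].

Definition linf_sphere : set 'rV[R]_n := [set x | `|x| = 1].

Definition dual_norm g : R := sup [set `|g x| | x in linf_ball].

Definition norm_attainment g : set 'rV[R]_n :=
  [set x | linf_sphere x /\ `|g x| = dual_norm g].

End Duality.

Lemma linf_coord_le (R : realType) (n : nat) (x : 'rV[R]_n) (i : 'I_n) :
  `|x ord0 i| <= `|x|.
Proof.
rewrite [leRHS]/Num.norm/= mx_normrE.
exact: (le_bigmax _ (fun ij : 'I_1 * 'I_n => `|x ij.1 ij.2|) (ord0, i)).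
Qed.

Arguments linf_ball : clear implicits.
Arguments linf_sphere : clear implicits.

Definition extreme_points (R : realType) (V : lmodType R) (C : set V) : set V :=
  [set x | C x /\ forall (y z : V) (t : R), C y -> C z -> 0 < t < 1 ->
             x = t *: y + (1 - t) *: z -> y = x /\ z = x].

Lemma linf_ballP (R : realType) (n : nat) (x : 'rV[R]_n) :
  linf_ball R n x <-> forall i, `|x ord0 i| <= 1.
Proof.
split=> [x1 i|x1]; first exact: le_trans (linf_coord_le x i) x1.
rewrite /linf_ball/= [leLHS]/Num.norm/= mx_normrE.
by apply/bigmax_leP; split=> // -[j i] _ /=; rewrite ord1.
Qed.

Lemma dual_norm_psi (R : realType) (n : nat) (b : 'rV[R]_n) :
  dual_norm (psi b) = l1norm b.
Proof.
pose s : 'rV[R]_n := \row_i Num.sg (b ord0 i).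
have sB : linf_ball R n s.
  by apply/linf_ballP => i; rewrite mxE normr_sg; case: (_ != 0).
have bs : psi b s = l1norm b.
  by apply: eq_bigr => i _; rewrite mxE mulrC normrEsg.
have l1_ge0 : 0 <= l1norm b by apply: sumr_ge0.
have ub : ubound [set `|psi b x| | x in linf_ball R n] (l1norm b).
  move=> _ [x /linf_ballP x1 <-]; apply: le_trans (ler_norm_sum _ _ _) _.
  by apply: ler_sum => i _; rewrite normrM ler_piMr.
have inS : [set `|psi b x| | x in linf_ball R n] (l1norm b).
  by exists s => //; rewrite bs ger0_norm.
apply/eqP; rewrite eq_le; apply/andP; split.
  by apply: ge_sup => //; exists (l1norm b).
by apply: ub_le_sup => //; exists (l1norm b).
Qed.

Lemma extreme_points_linf_ball (R : realType) (n : nat) :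
  extreme_points (linf_ball R n) =
  [set x : 'rV[R]_n | forall i, x ord0 i = 1 \/ x ord0 i = -1].
Proof.
apply/seteqP; split=> [x [/linf_ballP x1 xext] i|x xpm].
- have [xi1|] := eqVneq `|x ord0 i| 1.
    have [x0|x0] := leP 0 (x ord0 i).
      by left; rewrite -xi1 ger0_norm.
    by right; rewrite -xi1 ltr0_norm// opprK.
  move=> xi1; exfalso.
  have {}xi1 : `|x ord0 i| < 1 by rewrite lt_neqAle xi1 x1.
  pose e := 1 - `|x ord0 i|.
  have e0 : 0 < e by rewrite subr_gt0.
  have ball_pert (s : R) : `|s| = e ->
      linf_ball R n (x + s *: delta_mx ord0 i).
    move=> se; apply/linf_ballP => j; rewrite !mxE eqxx/=.
    have [->|_] := eqVneq j i; last by rewrite mulr0 addr0.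
    rewrite mulr1; apply: le_trans (ler_normD _ _) _.
    by rewrite se addrC subrK.
  have [] := xext (x + e *: delta_mx ord0 i) (x + (- e) *: delta_mx ord0 i) 2^-1.
  + by apply: ball_pert; rewrite gtr0_norm.
  + by apply: ball_pert; rewrite normrN gtr0_norm.
  + by rewrite invr_gt0 ltr0n/= invf_lt1 ?ltr1n ?ltr0n.
  + have -> : 1 - 2^-1 = 2^-1 :> R by rewrite [X in X - _](splitr 1) mul1r addrK.
    rewrite -scalerDr addrACA -scalerDl subrr scale0r addr0.
    by rewrite -mulr2n -[x *+ 2]scaler_nat scalerA mulVf ?scale1r// pnatr_eq0.
  move=> + _ => /rowP/(_ i); rewrite !mxE !eqxx mulr1 => /eqP.
  by rewrite -subr_eq0 addrAC subrr add0r (gt_eqF e0).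
- have x1 i : `|x ord0 i| = 1.
    by have [->|->] := xpm i; rewrite ?normrN normr1.
  split; first by apply/linf_ballP => i; rewrite x1.
  move=> y z t /linf_ballP yB /linf_ballP zB /andP[t0 t1] xE.
  suff H i : y ord0 i = x ord0 i /\ z ord0 i = x ord0 i.
    by split; apply/rowP => i; have [] := H i.
  have {}xE : x ord0 i = t * y ord0 i + (1 - t) * z ord0 i.
    by rewrite xE !mxE.
  have := yB i; have := zB i; rewrite !ler_norml => /andP[z1 z2] /andP[y1 y2].
  have [xi|xi] := xpm i; rewrite xi in xE *.
    split; apply/eqP; rewrite eq_le; apply/andP; split => //.
      by rewrite leNgt; apply/negP => h; nra.
    by rewrite leNgt; apply/negP => h; nra.
  split; apply/eqP; rewrite eq_le; apply/andP; split => //.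
    by rewrite leNgt; apply/negP => h; nra.
  by rewrite leNgt; apply/negP => h; nra.
Qed.

Section Norming.
Variables (R : realType) (n : nat).
Implicit Types (Y : {vspace 'rV[R]_n}) (N M : set 'rV[R]_n).

Definition symmetric_set N : Prop := forall x, N x -> N (- x).

Definition norming_set Y N : Prop :=
  symmetric_set N /\
  forall g : {scalar 'rV[R]_n}, ((@psi R n) @` [set` Y]) g ->
    (norm_attainment g `&` extreme_points (linf_ball R n)) `&` N !=set0.

Definition minimal_norming_set Y N : Prop :=
  norming_set Y N /\ forall M, norming_set Y M -> M `<=` N -> M = N.

End Norming.

(* [<<_>>%VS] only takes finite sequences; [span_set S] is the linear span of  *)
(* an arbitrary set, as [span_setP] and [span_set_min] show.                   *)
Definition span_set (K : fieldType) (V : vectType K) (S : set V) : {vspace V} :=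
  xget 0%VS [set U : {vspace V} | forall v, v \in U <->
    exists2 X : seq V, (forall w, w \in X -> S w) & v \in <<X>>%VS].

Lemma span_setP (K : fieldType) (V : vectType K) (S : set V) (v : V) :
  v \in span_set S <->
  exists2 X : seq V, (forall w, w \in X -> S w) & v \in <<X>>%VS.
Proof.
suff [U PU] : exists U : {vspace V}, forall v, v \in U <->
    exists2 X : seq V, (forall w, w \in X -> S w) & v \in <<X>>%VS.
  exact: (xgetI 0%VS (P := [set U : {vspace V} | forall v, v \in U <->
    exists2 X : seq V, (forall w, w \in X -> S w) & v \in <<X>>%VS]) PU v).
pose D d := `[< exists2 X : seq V, (forall w, w \in X -> S w) & \dim <<X>> = d >].
have exD : exists d, D d.
  by exists (\dim <<[::] : seq V>>); apply/asboolP; exists [::].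
have ubD d : D d -> (d <= \dim {:V})%N.
  by move=> /asboolP[X _ <-]; exact: dimvS (subvf _).
case: (ex_maxnP exD ubD) => d /asboolP[X XS Xd] dmax.
exists <<X>>%VS => u; split=> [us|[X' XS' uX']]; first by exists X.
have le_XX : (<<X>> <= <<X ++ X'>>)%VS by rewrite span_cat addvSl.
have : \dim <<X ++ X'>> = \dim <<X>>.
  apply/eqP; rewrite eqn_leq (dimvS le_XX) andbT Xd; apply: dmax; apply/asboolP.
  exists (X ++ X') => // w; rewrite mem_cat => /orP[]; [exact: XS|exact: XS'].
move=> dimE; have -> : <<X>>%VS = <<X ++ X'>>%VS.
  by apply/eqP; rewrite eqEdim le_XX dimE leqnn.
by rewrite span_cat (subvP (addvSr _ _)).
Qed.

Lemma span_set_min (K : fieldType) (V : vectType K) (S : set V)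
    (U : {vspace V}) :
  (span_set S <= U)%VS <-> (forall v, S v -> v \in U).
Proof.
split=> [/subvP SU v Sv|SU].
  apply: SU; apply/span_setP; exists [:: v]; last by rewrite span_seq1 memv_line.
  by move=> w; rewrite inE => /eqP ->.
apply/subvP => v /span_setP[X XS]; apply/subvP/span_subvP => w /XS; exact: SU.
Qed.

(* Main.v *)
(** An element [y0] of [Y] is a best coapproximation to [x] exactly when
    [z = x - y0] satisfies [|y| <= |z + y|] for every [y] in [Y], so [Y] is
    anti-coproximinal iff only [z = 0] has this property.  If all of [Y]
    vanishes at the coordinate [i], the unit vector [e_i] has it.  Otherwise
    every [y] in [Y] can be perturbed inside [Y] to a vector without zero
    coordinates and with the signs of [y] on the support of [y]; hence the
    minimal norming set [N] consists of the sign vectors of the elements of [Y]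
    of full support.  Comparing [|t y|] with [|z + t y|] for large [t] shows that
    [z] has the property iff it annihilates [N], and no nonzero [z] annihilates
    [N] iff [N] spans the space. *)
Require Import Defs.
From mathcomp Require Import all_boot all_order all_algebra.
From mathcomp Require Import all_classical all_reals all_analysis.
From mathcomp Require Import lra.

Set Implicit Arguments.
Unset Strict Implicit.
Unset Printing Implicit Defensive.

Import Order.TTheory GRing.Theory Num.Theory.

Local Open Scope classical_set_scope.
Local Open Scope ring_scope.

(** * Signs under small perturbations *)

Lemma sgrD_small (R : realDomainType) (a b : R) :
  `|b| < `|a| -> Num.sg (a + b) = Num.sg a.
Proof.
have [a0|a0|->] := ltgtP a 0; last by rewrite normr0 normr_lt0.
  rewrite (ltr0_norm a0) ltr_norml opprK => /andP[_ h].
  by rewrite !ltr0_sg//; lra.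
rewrite (gtr0_norm a0) ltr_norml => /andP[h _].
by rewrite !gtr0_sg//; lra.
Qed.

Section SmallMultiple.
Variables (R : realType) (n : nat).
Implicit Types u v : 'rV[R]_n.

Lemma small_multiple u v : exists2 e : R, 0 < e &
  forall i, u ord0 i != 0 -> `|e * v ord0 i| < `|u ord0 i|.
Proof.
(* The [1 +] avoids division by zero and makes the final bound strict; the default 1 of the minimum
   covers [u = 0]. *)
pose f i := `|u ord0 i| / (1 + `|v ord0 i|).
have v1 i : 0 < 1 + `|v ord0 i| by rewrite ltr_pwDl.
exists (\big[Num.min/1]_(i | u ord0 i != 0) f i).
  apply/bigmin_gtP; split=> // i ui0.
  by rewrite divr_gt0// normr_gt0.
set e := \big[_/_]_(i | _) _ => i ui0.
have e0 : 0 < e.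
  apply/bigmin_gtP; split=> // j uj0.
  by rewrite divr_gt0// normr_gt0.
have : e <= f i by exact: bigmin_le_cond.
rewrite /f ler_pdivlMr// normrM (gtr0_norm e0).
lra.
Qed.

(** Induction on the number of zero coordinates: a small multiple of an element of [Y] that is
    nonzero at one of them removes this zero and keeps all signs on the support. *)
Lemma full_support_extension (Y : {vspace 'rV[R]_n}) u :
  (forall i, exists2 y, y \in Y & y ord0 i != 0) -> u \in Y ->
  exists v, [/\ v \in Y, forall i, v ord0 i != 0 &
    forall i, u ord0 i != 0 -> Num.sg (v ord0 i) = Num.sg (u ord0 i)].
Proof.
move=> Y0; have [k] := ubnP #|[pred i | u ord0 i == 0]|.
elim: k u => // k IH u; rewrite ltnS => uk uY.
have [/existsP[i /eqP ui0]|/existsPn u0] := boolP [exists i, u ord0 i == 0];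
  last by exists u.
have [y yY yi0] := Y0 i.
have [e e0 he] := small_multiple u y.
pose w := u + e *: y.
have wsg j : u ord0 j != 0 -> Num.sg (w ord0 j) = Num.sg (u ord0 j).
  by move=> uj0; rewrite !mxE sgrD_small// he.
have w0 j : u ord0 j != 0 -> w ord0 j != 0.
  by move=> uj0; rewrite -sgr_eq0 wsg// sgr_eq0.
have wY : w \in Y by rewrite rpredD// rpredZ.
have [|v [vY v0 vsg]] := IH w _ wY.
  apply: leq_trans uk; apply: proper_card; apply/fintype.properP; split.
    apply/fintype.subsetP => j; rewrite !inE => /eqP wj; apply/negPn/negP => /w0.
    by rewrite wj eqxx.
  exists i; first by rewrite inE ui0.
  by rewrite inE /w !mxE ui0 add0r mulf_neq0// gt_eqF.
by exists v; split=> // j uj0; rewrite vsg ?w0// wsg.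
Qed.

End SmallMultiple.

Section L1Duality.
Variables (R : realType) (n : nat).
Implicit Types (Y U : {vspace 'rV[R]_n}) (x y z s : 'rV[R]_n).
Implicit Types N S : set 'rV[R]_n.

(** * Sign vectors and the pairing *)

Definition sgv y : 'rV[R]_n := map_mx Num.sg y.

Lemma sgvN y : sgv (- y) = - sgv y.
Proof. by apply/rowP => i; rewrite !mxE sgrN. Qed.

Lemma pairing_sgv y : pairing y (sgv y) = l1norm y.
Proof. by apply: eq_bigr => i _; rewrite mxE mulrC normrEsg. Qed.

Lemma pairingDl x y s : pairing (x + y) s = pairing x s + pairing y s.
Proof.
by rewrite /pairing -big_split; apply: eq_bigr => i _; rewrite mxE mulrDl.
Qed.

Lemma l1normN y : l1norm (- y) = l1norm y.
Proof. by apply: eq_bigr => i _; rewrite mxE normrN. Qed.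

Lemma pairing_le_l1norm y s : linf_ball R n s -> `|pairing y s| <= l1norm y.
Proof.
move=> /linf_ballP s1; apply: le_trans (ler_norm_sum _ _ _) _.
by apply: ler_sum => i _; rewrite normrM ler_piMr.
Qed.

(** The two sides differ by a sum of nonnegative terms, so each term vanishes. *)
Lemma pairing_eq_l1norm y s : linf_ball R n s -> pairing y s = l1norm y ->
  forall i, y ord0 i != 0 -> s ord0 i = Num.sg (y ord0 i).
Proof.
move=> /linf_ballP s1 /esym/eqP; rewrite -subr_eq0 /l1norm /pairing -sumrB.
have ge0 i : 0 <= `|y ord0 i| - y ord0 i * s ord0 i.
  rewrite subr_ge0 (le_trans (ler_norm _))// normrM ler_piMr//.
rewrite psumr_eq0// => /allP h i yi0.
have := h i; rewrite mem_index_enum => /(_ isT) /=.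
rewrite normrEsg mulrC -mulrBr mulf_eq0 (negPf yi0) subr_eq0.
by move=> /eqP.
Qed.

Lemma extreme_sgv y : (forall i, y ord0 i != 0) ->
  extreme_points (linf_ball R n) (sgv y).
Proof.
rewrite extreme_points_linf_ball => y0 i; rewrite mxE.
by have [h|h|/eqP] := ltgtP (y ord0 i) 0;
  [right; exact: ltr0_sg|left; exact: gtr0_sg|rewrite (negPf (y0 i))].
Qed.

Lemma anti_coproximinalP Y : anti_coproximinal Y <->
  forall z, (forall y, y \in Y -> l1norm y <= l1norm (z + y)) -> z = 0.
Proof.
split=> [aY z zY|Y0 x xY [y0 [y0Y hy0]]].
  apply/eqP/negPn/negP => z0.
  (* If [z] is in [Y], testing with [- z] gives [l1norm z <= 0]; otherwise 0 is a best
     coapproximation to [z]. *)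
  have [zinY|/aY[]] := boolP (z \in Y).
    have := zY (- z); rewrite rpredN zinY subrr l1normN => /(_ isT).
    rewrite [leRHS]/l1norm big1 => [|i _]; last by rewrite mxE normr0.
    move=> h; have {h} : l1norm z == 0 by rewrite eq_le h sumr_ge0.
    rewrite psumr_eq0// => /allP h; case/eqP: z0; apply/rowP => i.
    have := h i; rewrite mem_index_enum => /(_ isT).
    by rewrite mxE normr_eq0 => /eqP.
  exists 0; split=> [|y yY]; first exact: mem0v.
  by rewrite sub0r l1normN -[l1norm y]l1normN; apply: zY; rewrite rpredN.
have /subr0_eq xy0 : x - y0 = 0; last by rewrite xy0 y0Y in xY.
apply: Y0 => y yY.
have := hy0 (y0 - y); rewrite rpredB// => /(_ isT).
by rewrite !opprB addrC subrK addrA addrAC.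
Qed.

(** With a basis of [U] as the rows of [X], the matrix [X^T] has [n] rows and rank below [n], hence
    a nonzero left kernel. *)
Lemma exists_annihilator U : (\dim U < n)%N ->
  exists2 z, z != 0 & forall u, u \in U -> pairing z u = 0.
Proof.
move=> dU.
pose X : 'M[R]_(\dim U, n) := \matrix_k tnth (vbasis U) k.
have K0 : kermx X^T != 0.
  rewrite -mxrank_eq0 mxrank_ker mxrank_tr subn_eq0 -ltnNge.
  exact: leq_ltn_trans (rank_leq_row _) dU.
have zX : nz_row (kermx X^T) *m X^T = 0.
  by apply/sub_kermxP; exact: nz_row_sub.
exists (nz_row (kermx X^T)) => [|u uU]; first by rewrite nz_row_eq0.
rewrite (coord_vbasis uU) linear_sum big1// => k _; rewrite linearZ /=.
have -> : pairing (nz_row (kermx X^T)) (vbasis U)`_k = 0.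
  move/rowP: zX => /(_ k); rewrite !mxE => h; rewrite -[RHS]h.
  by apply: eq_bigr => j _; rewrite !mxE (tnth_nth 0).
by rewrite mulr0.
Qed.

Lemma dim_span_setP S : \dim (span_set S) = n <->
  forall z, (forall s, S s -> pairing z s = 0) -> z = 0.
Proof.
split=> [dS z zS|S0].
  have full : span_set S = fullv.
    by apply/eqP; rewrite eqEdim subvf dS dimvf /dim /= mul1n.
  have z0 v : pairing z v = 0.
    have /span_setP[X XS vX] : v \in span_set S by rewrite full memvf.
    rewrite (coord_span (X := in_tuple X) vX) linear_sum big1// => k _.
    by rewrite linearZ /= zS ?mulr0//; apply/XS/mem_nth.
  (* Pairing [z] with its own sign vector gives its norm. *)
  have /eqP := z0 (sgv z); rewrite pairing_sgv psumr_eq0// => /allP h.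
  apply/rowP => i; have := h i; rewrite mem_index_enum => /(_ isT).
  by rewrite mxE normr_eq0 => /eqP.
apply/eqP; rewrite eqn_leq; apply/andP; split.
  by have := dimvS (subvf (span_set S)); rewrite dimvf /dim /= mul1n.
rewrite leqNgt; apply/negP => /exists_annihilator[z z0 hz].
case/eqP: z0; apply: S0 => s Ss; apply: hz.
by have /span_set_min := subvv (span_set S); apply.
Qed.

(** * Norming sets *)

Lemma norming_setP Y N : (0 < n)%N -> norming_set Y N <->
  symmetric_set N /\ forall y, y \in Y -> exists s,
    [/\ N s, extreme_points (linf_ball R n) s & pairing y s = l1norm y].
Proof.
move=> n0; split=> -[sN hN]; split=> //.
  move=> y yY; have [|s [[[_ ys] es] Ns]] := hN (psi y); first by exists y.
  move: ys; rewrite dual_norm_psi /= => ys.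
  (* Symmetry of [N] allows [s] to be replaced by [- s], which removes the absolute value. *)
  have [ps|ps] := leP 0 (pairing y s).
    by exists s; split=> //; rewrite -ys ger0_norm.
  exists (- s); split; first exact: sN.
    move: es; rewrite extreme_points_linf_ball => es i.
    by rewrite mxE; have [->|->] := es i; rewrite ?opprK; [right|left].
  by rewrite linearN -ys ltr0_norm.
move=> _ [y yY <-]; have [s [Ns es ys]] := hN y yY.
exists s; split=> //; split=> //; split.
  (* Norm exactly 1 needs some coordinate, hence [0 < n]. *)
  rewrite /linf_sphere /=; apply/eqP; rewrite eq_le; apply/andP; split.
    by case: es.
  move: es; rewrite extreme_points_linf_ball => es.
  apply: le_trans (linf_coord_le s (Ordinal n0)).
  by have [->|->] := es (Ordinal n0); rewrite ?normrN normr1.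
rewrite dual_norm_psi /= ys ger0_norm//; exact: sumr_ge0.
Qed.

Lemma minimal_norming_setE Y N : (0 < n)%N ->
  (forall i, exists2 y, y \in Y & y ord0 i != 0) ->
  minimal_norming_set Y N ->
  N = [set sgv y | y in [set y | y \in Y /\ forall i, y ord0 i != 0]].
Proof.
move=> n0 Y0 [/(norming_setP _ _ n0)[sN hN] minN]; apply/esym/minN.
  apply/(norming_setP _ _ n0); split.
    move=> _ [y [yY y0] <-]; rewrite -sgvN; exists (- y) => //.
    by split=> [|i]; rewrite ?rpredN// mxE oppr_eq0.
  move=> y yY; have [v [vY v0 vy]] := full_support_extension Y0 yY.
  exists (sgv v); split; [by exists v|exact: extreme_sgv|].
  apply: eq_bigr => i _; rewrite mxE.
  have [->|yi0] := eqVneq (y ord0 i) 0; first by rewrite mul0r normr0.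
  by rewrite vy// mulrC normrEsg.
(* A vector of full support is normed by its sign vector alone, so every norming set contains it. *)
move=> _ [y [yY y0] <-]; have [s [Ns [es _] ys]] := hN y yY.
suff -> : sgv y = s by [].
by apply/rowP => i; rewrite mxE (pairing_eq_l1norm es ys).
Qed.

(** Once [t] is so large that [z + t *: y] has the signs of [y], both norms in the hypothesis are
    pairings with [sgv y], and the terms in [y] cancel; [t] is [e^-1] below. *)
Lemma pairing_sgv_ge0 Y z y :
  (forall y, y \in Y -> l1norm y <= l1norm (z + y)) ->
  y \in Y -> (forall i, y ord0 i != 0) -> 0 <= pairing z (sgv y).
Proof.
move=> zY yY y0; have [e e0 he] := small_multiple y z.
have ey0 i : `|z ord0 i| < `|(e^-1 *: y) ord0 i|.
  rewrite mxE normrM gtr0_norm ?invr_gt0// ltr_pdivlMl//.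
  by have := he i (y0 i); rewrite normrM gtr0_norm.
have sE : sgv (e^-1 *: y) = sgv y.
  by apply/rowP => i; rewrite !mxE sgrM gtr0_sg ?invr_gt0// mul1r.
have sE' : sgv (z + e^-1 *: y) = sgv y.
  rewrite -sE; apply/rowP => i; have := ey0 i; rewrite !mxE addrC.
  exact: sgrD_small.
have := zY (e^-1 *: y); rewrite rpredZ// => /(_ isT).
by rewrite -!pairing_sgv sE sE' pairingDl lerDr.
Qed.

Lemma orthogonal_minimal_norming_set Y N z : (0 < n)%N ->
  (forall i, exists2 y, y \in Y & y ord0 i != 0) ->
  minimal_norming_set Y N ->
  (forall y, y \in Y -> l1norm y <= l1norm (z + y)) <->
  (forall s, N s -> pairing z s = 0).
Proof.
move=> n0 Y0 mN; split=> [zY|zN].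
  rewrite (minimal_norming_setE n0 Y0 mN) => _ [y [yY y0] <-].
  apply/eqP; rewrite eq_le (pairing_sgv_ge0 zY yY y0) andbT.
  rewrite -oppr_ge0 -linearN -sgvN; apply: (pairing_sgv_ge0 zY).
    by rewrite rpredN.
  by move=> i; rewrite mxE oppr_eq0.
(* Some [s] in [N] norms [y], and adding [z] does not change the pairing with [s]. *)
case: mN => /(norming_setP _ _ n0)[_ hN] _ y /hN[s [Ns [bs _] <-]].
rewrite -[leLHS]add0r -(zN s Ns) -pairingDl.
exact: le_trans (ler_norm _) (pairing_le_l1norm _ bs).
Qed.

Lemma coord_eq0_not_anti_coproximinal Y (i : 'I_n) :
  (forall y, y \in Y -> y ord0 i = 0) -> ~ anti_coproximinal Y.
Proof.
move=> Yi /anti_coproximinalP aY.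
have /rowP/(_ i) : delta_mx ord0 i = 0 :> 'rV[R]_n.
  apply: aY => y yY; apply: ler_sum => j _; rewrite !mxE eqxx /=.
  have [->|_] := eqVneq j i; first by rewrite (Yi _ yY) normr0.
  by rewrite add0r.
by rewrite !mxE !eqxx => /eqP; rewrite oner_eq0.
Qed.

End L1Duality.

Theorem theorem2p31 (R : realType) (n m : nat) (hm : (1 < m)%N) (hmn : (m < n)%N)
    (Y : {vspace 'rV[R]_n}) (A : m.-tuple 'rV[R]_n) (hA : basis_of Y A) :
  (zero_set A !=set0 -> ~ anti_coproximinal Y) /\
  (zero_set A = set0 ->
     forall N : set 'rV[R]_n, minimal_norming_set Y N ->
       (anti_coproximinal Y <-> \dim (span_set N) = n)).
Proof.
split=> [[i Ai]|A0 N mN].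
  apply: (@coord_eq0_not_anti_coproximinal _ _ _ i) => y yY.
  rewrite (coord_basis hA yY) summxE big1// => k _.
  by rewrite mxE -tnth_nth Ai mulr0.
have n0 : (0 < n)%N by exact: leq_ltn_trans hmn.
have Y0 i : exists2 y, y \in Y & y ord0 i != 0.
  apply: contrapT => Yi; suff : zero_set A i by rewrite A0.
  move=> k; apply/eqP/negPn/negP => Ak; apply: Yi; exists (tnth A k) => //.
  exact: basis_mem hA (mem_tnth k A).
have orthN z := orthogonal_minimal_norming_set z n0 Y0 mN.
apply: (iff_trans (anti_coproximinalP Y)).
apply: (iff_trans _ (iff_sym (dim_span_setP N))).
by split=> h z /orthN; exact: h.
Qed.
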